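(* For any sequence $s$ of cardinals the following are equivalent: (1) $s=\mathrm{CS}(X)$ for some regular scattered space $X$; (2) $s=\mathrm{CS}(X)$ for some $0$-dimensional scattered space $X$; (3) for some natural number $m$ there are infinite cardinals $\kappa_0>\kappa_1>\dots>\kappa_{m-1}$ and, for each $i<m$, a sequence $s_i\in S_{\kappa_i}$ such that either $s=s_0{}^\frown s_1{}^\frown\cdots{}^\frown s_{m-1}$ or $s=s_0{}^\frown s_1{}^\frown\cdots{}^\frown s_{m-1}{}^\frown\langle n\rangle$ for some natural number $n>0$.
   Context: For a scattered space $X$, $I_\alpha(X)$ is the set of isolated points of $X\setminus\bigcup_{\beta<\alpha}I_\beta(X)$; $\mathrm{ht}(X)$ is the least $\alpha$ with $I_\alpha(X)=\emptyset$; $\mathrm{CS}(X)=\langle|I_\alpha(X)|:\alpha<\mathrm{ht}(X)\rangle$. For an infinite cardinal $\kappa$, $S_\kappa$ is the set of all sequences of cardinals $\langle\kappa_i:i<\delta\rangle$ with $\delta<(2^\kappa)^+$, $\kappa_0=\kappa$, and $\kappa\le\kappa_i\le2^\kappa$ for all $i<\delta$. ${}^\frown$ denotes concatenation of sequences. *)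

(* Defs.v *)
From mathcomp Require Import all_boot all_order.
From mathcomp Require Import all_classical topology wochoice.

Set Implicit Arguments.
Unset Strict Implicit.
Unset Printing Implicit Defensive.

Local Open Scope classical_set_scope.
Local Open Scope card_scope.

(* A cardinal is a type taken up to equipotence (#=, #<=), an ordinal is a
   well-ordered type taken up to order isomorphism.  The elements of an ordinal
   W stand for the ordinals smaller than W: w stands for {v | v < w}. *)
Definition cardinal := Type.

Record ordinal_type := OrdinalType {
  ord_sort :> Type;
  ord_le : rel ord_sort;
  ord_wo : well_order ord_le }.

Definition ord_lt (W : ordinal_type) (v w : W) : bool := ~~ ord_le w v.

Section OrdinalFacts.
Variable W : ordinal_type.

Lemma ord_le_total : total (@ord_le W).
Proof.
move=> x y.
have [|z [[zA zlb] _]] := @ord_wo W (fun z => `[< z = x \/ z = y >]).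
  by exists x; apply/asboolP; left.
have [zx zy] : ord_le z x /\ ord_le z y.
  by split; apply: zlb; apply/asboolP; [left|right].
by move/asboolP: zA => [<-|<-]; rewrite ?zx ?zy ?orbT.
Qed.

Lemma ord_lexx : reflexive (@ord_le W).
Proof. by move=> x; rewrite -[ord_le x x]orbb ord_le_total. Qed.

Lemma ord_le_anti : antisymmetric (@ord_le W).
Proof.
move=> x y /andP[xy yx].
have [|z [_ uz]] := @ord_wo W (fun z => `[< z = x \/ z = y >]).
  by exists x; apply/asboolP; left.
rewrite -(uz x) ?(uz y) //.
  split; first by apply/asboolP; right.
  by move=> t /asboolP[->|->]; rewrite ?ord_lexx.
split; first by apply/asboolP; left.
by move=> t /asboolP[->|->]; rewrite ?ord_lexx.
Qed.

Lemma ord_lt_wf : well_founded (@ord_lt W).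
Proof.
move=> x; apply: contrapT => nAx.
have [|z [[/asboolP zA zlb] _]] :=
  @ord_wo W (fun z => `[< ~ Acc (@ord_lt W) z >]).
  by exists x; apply/asboolP.
apply: zA; apply: Acc_intro => y yz; apply: contrapT => nAy.
by move/negP: yz; apply; apply: zlb; apply/asboolP.
Qed.

End OrdinalFacts.

(* V < W: V is isomorphic to a proper initial segment of W *)
Definition ordinal_lt (V W : ordinal_type) : Prop :=
  exists (w : W) (f : V -> W),
    {mono f : x y / ord_le x y} /\ range f = [set v | ord_lt v w].

(* W is the initial ordinal of the successor cardinal K^+, i.e. the least
   ordinal whose cardinality exceeds K *)
Definition is_succ_cardinal (K : cardinal) (W : ordinal_type) : Prop :=
  ~ ([set: W] #<= [set: K]) /\ forall w : W, [set v | ord_lt v w] #<= [set: K].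

Definition cardinal_lt (K L : cardinal) : Prop :=
  [set: K] #<= [set: L] /\ [set: K] #!= [set: L].

Record cardseq := CardSeq {
  cs_len : ordinal_type;
  cs_term : cs_len -> cardinal }.

Definition cardseq_eq (s t : cardseq) : Prop :=
  exists f : cs_len s -> cs_len t,
    [/\ bijective f, {mono f : x y / ord_le x y} &
        forall i, [set: cs_term i] #= [set: cs_term (f i)]].

Section Concatenation.

Lemma void_wo : well_order (fun _ _ : void => true).
Proof. by move=> A [[]]. Qed.

Definition cs_nil : cardseq :=
  @CardSeq (OrdinalType void_wo) (fun _ => void).

Lemma unit_wo : well_order (fun _ _ : unit => true).
Proof. by move=> A [[] A0]; exists tt; split=> // -[]. Qed.

Definition cs_singleton (K : cardinal) : cardseq :=
  @CardSeq (OrdinalType unit_wo) (fun _ => K).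

Variables s t : cardseq.

Definition sum_le (x y : cs_len s + cs_len t) : bool :=
  match x, y with
  | inl a, inl b => ord_le a b
  | inl _, inr _ => true
  | inr _, inl _ => false
  | inr a, inr b => ord_le a b
  end.

Lemma sum_wo : well_order sum_le.
Proof.
apply: antisymmetric_well_order => [[a|a] [b|b] //=|A [x Ax]].
- by move=> /ord_le_anti->.
- by move=> /ord_le_anti->.
have [[a Aa]|nA] := pselect (exists a, inl a \in A).
  have [|z [[zA zlb] _]] := @ord_wo (cs_len s) (fun a => inl a \in A).
    by exists a.
  by exists (inl z); split=> // -[b|b] // bA; apply: zlb.
case: x Ax => [a Aa|b Ab]; first by case: nA; exists a.
have [|z [[zA zlb] _]] := @ord_wo (cs_len t) (fun a => inr a \in A).
  by exists b.
exists (inr z); split=> // -[c|c] cA; last exact: zlb.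
by case: nA; exists c.
Qed.

Definition cs_cat : cardseq :=
  @CardSeq (OrdinalType sum_wo)
    (fun x => match x with inl i => cs_term i | inr j => cs_term j end).

End Concatenation.

Fixpoint cs_concat (m : nat) : ('I_m -> cardseq) -> cardseq :=
  match m with
  | 0 => fun _ => cs_nil
  | m'.+1 => fun s => cs_cat (s ord0) (cs_concat (fun i => s (lift ord0 i)))
  end.

(* S_K contains no empty sequence: its members have a first term, K *)
Definition in_S (K : cardinal) (s : cardseq) : Prop :=
  [/\ exists W, is_succ_cardinal (K -> bool) W /\ ordinal_lt (cs_len s) W,
      exists i0 : cs_len s, (forall i, ord_le i0 i) /\
        [set: cs_term i0] #= [set: K] &
      forall i : cs_len s, [set: K] #<= [set: cs_term i] /\
        [set: cs_term i] #<= [set: K -> bool]].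

(* [regular_space] does not include any separation axiom between points *)
Definition regular_hausdorff (X : topologicalType) : Prop :=
  hausdorff_space X /\ regular_space X.

(* existence of a clopen base; the library's [zero_dimensional] only asks that
   clopen sets separate points *)
Definition zero_dim_hausdorff (X : topologicalType) : Prop :=
  hausdorff_space X /\
  exists B : set (set X), basis B /\ forall U, B U -> clopen U.

Definition scattered (X : topologicalType) : Prop :=
  forall A : set X, A !=set0 -> isolated A !=set0.

Section CantorBendixson.
Variables (X : topologicalType) (W : ordinal_type).

(* I_w(X), where w : W is seen as the ordinal {v | v < w} *)
Definition CB_level : W -> set X :=
  Fix (@ord_lt_wf W) (fun _ => set X)
    (fun w level => isolated (~` [set x | exists v (vw : ord_lt v w),
                                            level v vw x])).

Lemma CB_levelE (w : W) :
  CB_level w = isolated (~` \bigcup_(v in [set v | ord_lt v w]) CB_level v).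
Proof.
rewrite {1}/CB_level Fix_eq => [|v F G FG].
  congr (isolated (~` _)); apply/seteqP; split=> x.
    by move=> [v [vw vx]]; exists v.
  by move=> [v vw vx]; exists v, vw.
by congr (isolated (~` _)); apply/seteqP; split=> x [u [uv ux]];
  exists u, uv; rewrite ?FG // -FG.
Qed.

(* I_W(X) for the ordinal W itself, which is not among its own elements *)
Definition CB_level_at : set X := isolated (~` \bigcup_(w in [set: W]) CB_level w).

(* W = ht(X): the ordinals below W are its elements, so minimality of W says
   that every I_w(X) is nonempty *)
Definition is_height : Prop :=
  CB_level_at = set0 /\ forall w : W, CB_level w !=set0.


Definition CB_cardseq : cardseq :=
  @CardSeq W (fun w => set_type (CB_level w)).

End CantorBendixson.

Definition is_CS (s : cardseq) (X : topologicalType) : Prop :=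
  exists W, is_height X W /\ cardseq_eq s (CB_cardseq X W).

(* Main.v *)
(** Both topological conditions, and the combinatorial one, are equivalent to
    [bounded_tails s]: for every w that is not the last index, the term K w is
    infinite and the union of the later terms has at most 2^(K w) elements.

    In a regular scattered X the level I_w is dense in the union of the levels
    from w on.  Choosing for each later point x a neighbourhood V_x whose closure
    meets the derived set that isolates x only in x, the map sending x to the
    trace of V_x on I_w is injective.  A finite level is closed, hence last.

    Conversely, realize s on the disjoint union of its terms by a 0-1 matrix f:
    the basic neighbourhoods of x consist of the z agreeing with x on finitely
    many columns.  Column y is the indicator of y on the levels from that of y
    on, which makes y isolated there; below, level w carries a family of
    independent sets indexed by the later points, so that every later point is
    a limit of level w.

    Finally, the blocks s_i are cut out at the indices where K w drops strictly
    below all earlier terms, and there are finitely many because cardinals are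
    well founded. *)

Require Import Defs.
From HB Require Import structures.
From mathcomp Require Import all_boot all_order.
From mathcomp Require Import all_classical topology wochoice.

Set Implicit Arguments.
Unset Strict Implicit.
Unset Printing Implicit Defensive.

Local Open Scope classical_set_scope.
Local Open Scope card_scope.

(** * Cardinals *)

Definition embeds (X Y : Type) : Prop := exists f : X -> Y, injective f.

Lemma embedsP (X Y : Type) : ([set: X] #<= [set: Y]) <-> embeds X Y.
Proof.
split=> [/card_leP[f]|[f fI]].
  have toX x : x \in [set: X] by rewrite in_setT.
  exists (fun x => set_val (f (SigSub (toX x)))) => x y /val_inj.
  by move/(@inj _ _ _ f) => /(_ (mem_set I) (mem_set I)) /(congr1 val).
apply: inj_card_le; have := @Pinj _ _ setT f (in2W fI).
by case=> g _; exact: (totalfun g).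
Qed.

Lemma embeds_refl X : embeds X X.
Proof. by exists id. Qed.

Lemma embeds_trans Y X Z : embeds X Y -> embeds Y Z -> embeds X Z.
Proof. by move=> [f fI] [g gI]; exists (g \o f); exact: inj_comp. Qed.

Lemma embeds_anti X Y : embeds X Y -> embeds Y X -> [set: X] #= [set: Y].
Proof.
by move=> /embedsP XY /embedsP YX; rewrite card_eq_le XY YX.
Qed.

Lemma card_eq_embeds X Y : [set: X] #= [set: Y] -> embeds X Y /\ embeds Y X.
Proof. by rewrite card_eq_le => /andP[XY YX]; split; apply/embedsP. Qed.

Lemma infinite_embeds X : infinite_set [set: X] <-> embeds nat X.
Proof. by rewrite infiniteP embedsP. Qed.

Lemma embeds_surj X Y : embeds X Y -> X -> exists g : Y -> X, forall x, exists y, g y = x.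
Proof.
move=> [f fI] x0.
exists (fun y => if pselect (exists x, f x = y) is left h then sval (cid h) else x0).
move=> x; exists (f x); case: pselect => [h|[]]; last by exists x.
by apply: fI; exact: (svalP (cid h)).
Qed.

Lemma embeds_prod X X' Y Y' : embeds X X' -> embeds Y Y' -> embeds (X * Y) (X' * Y').
Proof.
move=> [f fI] [g gI]; exists (fun p => (f p.1, g p.2)) => -[a b] [c d] /= [].
by move=> /fI-> /gI->.
Qed.

Lemma embeds_pow X Y : embeds X Y -> embeds (X -> bool) (Y -> bool).
Proof.
move=> [f fI]; exists (fun a y => `[< exists2 x, f x = y & a x >]) => a b ab.
have fE (c : X -> bool) x : `[< exists2 x', f x' = f x & c x' >] = c x.
  by apply/asboolP/idP => [[x' /fI->]//|cx]; exists x.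
by apply/funext => x; have := congr1 (fun h => h (f x)) ab; rewrite /= !fE.
Qed.

Lemma embeds_powS X : embeds X (X -> bool).
Proof.
exists (fun x y => `[< x = y >]) => x y /(congr1 (fun f => f y)) xy.
by apply/asboolP; rewrite xy; apply/asboolP.
Qed.

(* In a maximal family of functions that pairwise differ everywhere, some
   coordinate takes all its values; the family then embeds that term in every
   other one. *)
Lemma min_card_family (I : Type) (K : I -> Type) :
  I -> exists i, forall j, embeds (K i) (K j).
Proof.
move=> i0.
pose apart (F : set (forall i, K i)) :=
  forall f g, F f -> F g -> forall i, f i = g i -> f = g.
have [|F [Fap Fmax]] := @Zorn_bigcup _ apart.
  move=> C Cap Ctot f g [A CA Af] [B CB Bg].
  have [AB|BA] := Ctot _ _ CA CB.
    exact: (Cap _ CB) (AB _ Af) Bg.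
  exact: (Cap _ CA) Af (BA _ Bg).
have [[i iF]|noi] := pselect (exists i, forall x, exists2 f, F f & f i = x).
  have /choice[h hP] : forall x, exists f, F f /\ f i = x.
    by move=> x; have [f Ff fx] := iF x; exists f.
  exists i => j; exists (fun x => h x j) => x y hxy.
  have [Fx hx] := hP x; have [Fy hy] := hP y.
  by rewrite -hx -hy (Fap _ _ Fx Fy _ hxy).
have [g gP] : exists g : forall i, K i, forall i f, F f -> f i <> g i.
  have gex i : {x : K i | forall f, F f -> f i <> x}.
    apply/cid; apply: contrapT => nx; apply: noi; exists i => x.
    apply: contrapT => nf; apply: nx; exists x => f Ff fx; apply: nf.
    by exists f.
  by exists (fun i => sval (gex i)) => i f; exact: (svalP (gex i)).
case: (Fmax (F `|` [set g])).
  split=> [f Ff|FE]; first by left.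
  have /(gP i0) : F g by apply: FE; right.
  exact.
move=> f h [Ff|->] [Fh|->] i //; first exact: Fap.
- by move=> /(gP i _ Ff).
- by move/esym => /(gP i _ Fh).
Qed.

Lemma embeds_total X Y : embeds X Y \/ embeds Y X.
Proof.
have [[] H] := @min_card_family bool (fun b => if b then X else Y) true.
  by left; exact: (H false).
by right; exact: (H true).
Qed.

(** The default [y0] off [A] makes the map total, so that maximal sets can be handled without
    subtypes. *)
Lemma embeds_on X Y (A : set X) (B : set Y) (y0 : Y) :
  embeds {x | A x} {y | B y} ->
  exists h : X -> Y, (forall x, A x -> B (h x)) /\
    forall x x', A x -> A x' -> h x = h x' -> x = x'.
Proof.
move=> [f fI].
exists (fun x => if pselect (A x) is left Ax then sval (f (exist _ x Ax)) else y0).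
split=> [x Ax|x x' Ax Ax']; first by case: pselect => // ?; case: (f _).
case: pselect => // ? ; case: pselect => // ? /eq_sig_hprop fE.
by have /fI[] := fE (fun _ _ _ => Prop_irrelevance _ _).
Qed.

Lemma left_inverse_on X Y (A : set X) (f : X -> Y) (x0 : X) :
  (forall x x', A x -> A x' -> f x = f x' -> x = x') ->
  exists g : Y -> X, forall x, A x -> g (f x) = x.
Proof.
move=> fI.
exists (fun y => if pselect (exists2 x, A x & f x = y) is left h
                 then s2val (cid2 h) else x0) => x Ax.
case: pselect => [h|[]]; last by exists x.
by case: (cid2 h) => x' /= Ax' /fI; exact.
Qed.

(* Take a maximal A, containing a countable set, with an injection f of A * A
   into A.  Either the complement of A embeds in A, so K embeds in A through two
   columns of f; or A embeds in its complement, and f extends to the union of A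
   and of this copy. *)
Lemma embeds_square K : embeds nat K -> embeds (K * K) K.
Proof.
move=> [e eI].
(* [p.2] is total, but constrained only on pairs from [p.1]. *)
pose good (p : set K * (K * K -> K)) :=
  [/\ forall n, p.1 (e n), forall x y, p.1 x -> p.1 y -> p.1 (p.2 (x, y)) &
      forall x y x' y', p.1 x -> p.1 y -> p.1 x' -> p.1 y' ->
        p.2 (x, y) = p.2 (x', y') -> (x, y) = (x', y')].
pose R (p q : sig good) := (sval p).1 `<=` (sval q).1 /\
  forall x y, (sval p).1 x -> (sval p).1 y -> (sval p).2 (x, y) = (sval q).2 (x, y).
have [e' e'K] : exists e' : K -> nat, cancel e e'.
  have [|e' e'K] := @left_inverse_on _ _ setT e 0; last by exists e' => x; exact: e'K.
  by move=> x x' _ _ /eI.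
(* The starting point is the range of [e], paired through the coding of pairs of naturals. *)
have good0 : good (range e, fun p => e (pickle (e' p.1, e' p.2))).
  split=> [n|_ _ [n _ <-] [m _ <-]|_ _ _ _ [n _ <-] [m _ <-] [n' _ <-] [m' _ <-]] /=.
  - by exists n.
  - by eexists; first by [].
  - by rewrite !e'K => /eI/(pcan_inj pickleK)[-> ->].
have [p|q p r /asboolP[pq pqE] /asboolP[qr qrE]|C /= Ctot|] :=
    @ZL_preorder (sig good) (exist _ _ good0) (fun p q => `[< R p q >]).
- by apply/asboolP; split.
- apply/asboolP; split; first exact: subset_trans qr.
  by move=> x y px py; rewrite pqE// qrE//; exact: pq.
- have {}Ctot p q : C p -> C q -> R p q \/ R q p.
    by move=> Cp Cq; have [/asboolP|/asboolP] := Ctot _ _ Cp Cq; [left|right].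
  have [[p0 Cp0]|C0] := pselect (exists p, C p); last first.
    by exists (exist _ _ good0) => s Cs; case: C0; exists s.
  pose A := [set x | exists2 p, C p & (sval p).1 x].
  have common x y : A x -> A y -> exists p, [/\ C p, (sval p).1 x & (sval p).1 y].
    move=> [p Cp px] [q Cq qy]; have [[pq _]|[qp _]] := Ctot _ _ Cp Cq.
      by exists q; split=> //; exact: pq.
    by exists p; split=> //; exact: qp.
  (* The pairings along a chain agree on common pairs, so they glue. *)
  have [f fE] : exists f, forall p, C p -> forall x y,
      (sval p).1 x -> (sval p).1 y -> f (x, y) = (sval p).2 (x, y).
    have H xy : exists z, forall p, C p ->
        (sval p).1 xy.1 -> (sval p).1 xy.2 -> z = (sval p).2 xy.
      case: xy => x y /=.
      have [[p [Cp px py]]|np] := pselect (exists p, [/\ C p, (sval p).1 x & (sval p).1 y]).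
        exists ((sval p).2 (x, y)) => q Cq qx qy.
        by have [[_ ->]|[_ <-]] := Ctot _ _ Cp Cq.
      by exists x => p Cp px py; case: np; exists p.
    have [f fP] := choice H; exists f => p Cp x y px py; exact: fP.
  have goodA : good (A, f).
    split=> [n|x y /= Ax Ay|x y x' y' /= Ax Ay Ax' Ay'].
    - by exists p0 => //; have [] := svalP p0.
    - have [p [Cp px py]] := common _ _ Ax Ay; rewrite (fE p)//.
      by exists p => //; have [_ + _] := svalP p; apply.
    have [p [Cp px py]] := common _ _ Ax Ay.
    have [q [Cq qx qy]] := common _ _ Ax' Ay'.
    have [[pq _]|[qp _]] := Ctot _ _ Cp Cq.
      rewrite !(fE q)//; try exact: pq.
      by have [_ _] := svalP q; apply=> //; exact: pq.
    rewrite !(fE p)//; try exact: qp.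
    by have [_ _] := svalP p; apply=> //; exact: qp.
  exists (exist _ _ goodA) => p Cp; apply/asboolP; split=> [x px|x y px py] /=; first by exists p.
  by rewrite (fE p).
move=> [[A f] gAf] Rmax; have [/= Ae Af fI] := gAf.
have e01 : e 0 <> e 1 by move=> /eI.
have [/(embeds_on (e 0))|/(embeds_on (e 0))] :=
    embeds_total {x | ~ A x} {x | A x}; move=> [h [hA hI]].
  (* [q] embeds [K] in [A]: points of [A] use column [e 0], the others are moved into [A] by [h] and
     use column [e 1]. *)
  pose q x := if pselect (A x) then f (e 0, x) else f (e 1, h x).
  have qA x : A (q x) by rewrite /q; case: pselect => ?; apply: Af => //; exact: hA.
  have qI : injective q.
    move=> x y; rewrite /q; case: pselect => Ax; case: pselect => Ay E.
    - by have [] := fI _ _ _ _ (Ae 0) Ax (Ae 0) Ay E.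
    - by have [/e01] := fI _ _ _ _ (Ae 0) Ax (Ae 1) (hA _ Ay) E.
    - by have [/esym/e01] := fI _ _ _ _ (Ae 1) (hA _ Ax) (Ae 0) Ay E.
    - have [] := fI _ _ _ _ (Ae 1) (hA _ Ax) (Ae 1) (hA _ Ay) E.
      exact: hI.
  exists (fun p => f (q p.1, q p.2)) => -[x y] [x' y'] /= E.
  by have [/qI-> /qI->] := fI _ _ _ _ (qA x) (qA y) (qA x') (qA y') E.
exfalso.
have [h' h'K] := left_inverse_on (e 0) hI.
(* [r] embeds [B] into [A], and [g] sends the new pairs into the copy of [A], away from the values
   of [f]; this contradicts maximality. *)
pose B := A `|` (h @` A).
pose r x := if pselect (A x) then f (e 0, x) else f (e 1, h' x).
have rA x : B x -> A (r x).
  rewrite /r; case: pselect => ? Bx /=; first exact: Af.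
  by case: Bx => // -[y Ay <-]; apply: Af => //; rewrite h'K.
have rI x y : B x -> B y -> r x = r y -> x = y.
  rewrite /r; case: pselect => Ax; case: pselect => Ay Bx By /= E.
  - by have [] := fI _ _ _ _ (Ae 0) Ax (Ae 0) Ay E.
  - have A'y : A (h' y) by case: By => // -[z Az <-]; rewrite h'K.
    by have [/e01] := fI _ _ _ _ (Ae 0) Ax (Ae 1) A'y E.
  - have A'x : A (h' x) by case: Bx => // -[z Az <-]; rewrite h'K.
    by have [/esym/e01] := fI _ _ _ _ (Ae 1) A'x (Ae 0) Ay E.
  - case: By E => // -[y' Ay' <-]; case: Bx => // -[x' Ax' <-]; rewrite !h'K// => E.
    by have [->] := fI _ _ _ _ (Ae 1) Ax' (Ae 1) Ay' E.
pose g p := if pselect (A p.1 /\ A p.2) then f p else h (f (r p.1, r p.2)).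
have goodB : good (B, g).
  split=> [n|x y /= Bx By|x y x' y' /= Bx By Bx' By'].
  - by left.
  - rewrite /g; case: pselect => [[Ax Ay]|nA] /=; first by left; exact: Af.
    by right; exists (f (r x, r y)) => //; apply: Af; exact: rA.
  rewrite /g /=; case: pselect => [[Ax Ay]|nA]; case: pselect => [[Ax' Ay']|nA'] /=.
  - exact: fI.
  - by move=> ffh; have /hA := Af _ _ (rA _ Bx') (rA _ By'); rewrite -ffh; case; exact: Af.
  - by move=> ffh; have /hA := Af _ _ (rA _ Bx) (rA _ By); rewrite ffh; case; exact: Af.
  - move=> /(hI _ _ (Af _ _ (rA _ Bx) (rA _ By)) (Af _ _ (rA _ Bx') (rA _ By'))) E.
    by have [/rI-> // /rI->] := fI _ _ _ _ (rA _ Bx) (rA _ By) (rA _ Bx') (rA _ By') E.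
have /Rmax/asboolP[BA _] : `[< R (exist _ _ gAf) (exist _ _ goodB) >].
  by apply/asboolP; split=> [x Ax|x y Ax Ay] /=; [left|rewrite /g; case: pselect => // -[]].
have /BA /= : B (h (e 0)) by right; exists (e 0).
exact: hA.
Qed.

(** Iterated pairing is injective on lists of a given length; the length is coded alongside. *)
Lemma embeds_seq K : embeds nat K -> embeds (seq K) K.
Proof.
move=> Kinf; have [p pI] := embeds_square Kinf; have [e eI] := Kinf.
pose code := foldr (fun x a => p (x, a)) (e 0).
exists (fun l => p (e (size l), code l)) => l l' /pI[/eI sz].
elim: l l' sz => [|x l IH] [|x' l'] //= [/IH {}IH].
by move=> /pI[-> /IH->].
Qed.

Lemma embeds_sumid K : embeds nat K -> embeds (K + K) K.
Proof.
move=> Kinf; apply: embeds_trans (embeds_square Kinf); have [e eI] := Kinf.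
exists (fun x => match x with inl k => (e 0, k) | inr k => (e 1, k) end).
by move=> [x|x] [y|y] // [] => [-> //|/eI|/eI|->].
Qed.

(** A pair of subsets of [K] is a subset of [K + K]. *)
Lemma embeds_pow_square K :
  embeds nat K -> embeds ((K -> bool) * (K -> bool)) (K -> bool).
Proof.
move=> /embeds_sumid/embeds_pow; apply: embeds_trans.
exists (fun a x => match x with inl k => a.1 k | inr k => a.2 k end).
move=> [a b] [a' b'] /= E; congr (_, _); apply/funext => k.
  exact: (congr1 (fun h => h (inl k)) E).
exact: (congr1 (fun h => h (inr k)) E).
Qed.

Lemma embeds_sigma_pow K I (L : I -> Type) : embeds nat K ->
  embeds I (K -> bool) -> (forall i, embeds (L i) (K -> bool)) ->
  embeds {i & L i} (K -> bool).
Proof.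
move=> Kinf [f fI] /(_ _)/cid-/all_sig[g gI].
apply: embeds_trans (embeds_pow_square Kinf).
exists (fun x => (f (tag x), g _ (tagged x))) => -[i x] [j y] /= [/fI ij].
by case: _ / ij y => y /gI->.
Qed.

Lemma embeds_sum_pow K X Y : embeds nat K ->
  embeds X (K -> bool) -> embeds Y (K -> bool) -> embeds (X + Y) (K -> bool).
Proof.
move=> Kinf [f fI] [g gI]; apply: embeds_trans (embeds_pow_square Kinf).
have [e _] := Kinf.
exists (fun x => match x with inl a => (fun=> true, f a) | inr b => (fun=> false, g b) end).
have tf : (fun _ : K => true) <> (fun=> false) by move/(congr1 (fun h => h (e 0))).
by move=> [x|x] [y|y] // [] => [/fI->|/tf|/esym/tf|/gI->].
Qed.

(* Points of [K] code triples (l, S, n): the sample points l tell finitely many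
   elements of the power set apart, S lists the traces on l of those to be
   accepted, and n makes every pattern occur infinitely often. *)
Lemma independent_family K Y (S : set Y) (g : Y -> K -> bool) :
  embeds nat K -> (forall y y', S y -> S y' -> g y = g y' -> y = y') ->
  exists P : K -> Y -> bool, forall (F : set Y) (G : set K) (p : Y -> bool),
    finite_set F -> finite_set G -> F `<=` S ->
    exists z, ~ G z /\ forall y, F y -> P z y = p y.
Proof.
move=> Kinf gI; have [e eI] := Kinf.
pose D := (seq K * (seq (seq bool) * nat))%type.
have DK : embeds D K.
  apply: embeds_trans (embeds_square Kinf); apply: embeds_prod.
    exact: embeds_seq.
  apply: embeds_trans Kinf; exists pickle; exact: pcan_inj (@pickleK _).
have [dec decS] := embeds_surj DK ([::], ([::], 0)).
exists (fun z y => map (g y) (dec z).1 \in (dec z).2.1) => F G p finF finG FS.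
have [s Fs] : exists s : seq {classic Y}, F = [set` s] by apply/(finite_seqP (F : set {classic Y})).
(* [k] picks a coordinate where two functions differ, if there is one; sampled at all these
   coordinates, the members of [F] have distinct traces on [l]. *)
have [k kP] : exists k : Y * Y -> {classic K},
    forall yy, g yy.1 (k yy) = g yy.2 (k yy) -> g yy.1 = g yy.2.
  have H (yy : Y * Y) : exists k : {classic K}, g yy.1 k = g yy.2 k -> g yy.1 = g yy.2.
    have [[k yyk]|nk] := pselect (exists k, g yy.1 k <> g yy.2 k).
      by exists k => /yyk.
    exists (e 0) => _; apply/funext => k; apply: contrapT => yyk.
    by apply: nk; exists k.
  by have [k kP] := choice H; exists k.
pose l := [seq k (y, y') | y <- s, y' <- s].
have lP y y' : F y -> F y' -> map (g y) l = map (g y') l -> y = y'.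
  move=> Fy Fy' E; apply: gI; try exact: FS.
  have lE : {in (l : seq {classic K}), g y =1 g y'} by apply/eq_in_map.
  apply: (kP (y, y')); apply: lE; move: Fy Fy'; rewrite Fs.
  exact: (@allpairs_f {classic Y} {classic Y} {classic K} (fun a b => k (a, b))).
pose T := [seq map (g y) l | y <- s & p y].
have /choice[z zP] : forall n, exists z, dec z = (l, (T, n)) by move=> n; exact: decS.
(* The codes [z n] are pairwise distinct, so the finite [G] misses one. *)
have [n nG] : exists n, ~ G (z n).
  apply: contrapT => nG; apply: infinite_nat.
  have zG : forall n, G (z n) by move=> n; apply: contrapT => zn; apply: nG; exists n.
  have zI : injective z by move=> m n /(congr1 dec); rewrite !zP => -[].
  apply: card_le_finite finG; apply: card_le_trans (subset_card_le (_ : range z `<=` G)).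
    have : range z #= [set: nat] by apply: inj_card_eq => ? ? _ _; exact: zI.
    by rewrite card_eq_le => /andP[].
  by move=> _ [m _ <-].
exists (z n); split=> // y Fy; rewrite zP /=; apply/(@mapP {classic Y})/idP => /=.
  move=> [y']; rewrite mem_filter => /andP[py' sy'] /lP ->//.
  by rewrite Fs.
move=> py; exists y => //; rewrite mem_filter py /=.
by move: Fy; rewrite Fs.
Qed.

Lemma Tagged_inj (I : Type) (L : I -> Type) (i : I) : injective (Tagged L : L i -> {i & L i}).
Proof. exact: (@eq_from_Tagged {classic I} L i). Qed.

(** * The realizing space *)

(** For finite [F], the preimage under the row map [f] of a basic clopen set of the Cantor cube over
    [I]. *)
Definition cylinder (T I : Type) (f : T -> I -> bool) (F : set I) (x : T) : set T :=
  [set z | forall i, F i -> f z i = f x i].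

(** A copy of [T] that records [f], so that its topology may depend on the matrix. *)
Definition pattern_space (T I : Type) (f : T -> I -> bool) := T.

Section PatternSpace.
Variables (T I : Type) (f : T -> I -> bool).
Local Notation X := (pattern_space f).

Definition pattern_nbhs (x : X) : set_system X :=
  filter_from [set F : set I | finite_set F] (fun F => cylinder f F x).

HB.instance Definition _ := gen_eqMixin X.
HB.instance Definition _ := gen_choiceMixin X.
HB.instance Definition _ := hasNbhs.Build X pattern_nbhs.

Lemma pattern_nbhs_filter (x : X) : ProperFilter (nbhs x).
Proof.
apply: filter_from_proper => [|F _]; last by exists x.
apply: filter_from_filter; first by exists set0; exact: finite_set0.
move=> F G finF finG; exists (F `|` G); first by rewrite /= finite_setU.
by move=> z zFG; split=> i Fi; apply: zFG; [left|right].
Qed.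

Lemma pattern_nbhs_singleton (x : X) (A : set X) : nbhs x A -> A x.
Proof. by case=> F _; apply. Qed.

(** The cylinders over [F] are the classes of the relation of agreeing on [F]; for finite [F] this
    makes them both open and closed. *)
Lemma cylinder_eq F (x y : T) : cylinder f F x y -> cylinder f F y = cylinder f F x.
Proof.
move=> xy; apply/seteqP; split=> z zF i Fi; have := zF i Fi; rewrite (xy i Fi)//.
Qed.

Lemma pattern_nbhs_nbhs (x : X) (A : set X) : nbhs x A -> nbhs x (nbhs^~ A).
Proof.
move=> [F finF FA]; exists F => // y /cylinder_eq xy.
by exists F => //; rewrite xy.
Qed.

HB.instance Definition _ := Nbhs_isNbhsTopological.Build X
  pattern_nbhs_filter pattern_nbhs_singleton pattern_nbhs_nbhs.

Lemma cylinder_clopen F (x : X) : finite_set F -> clopen (cylinder f F x : set X).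
Proof.
move=> finF; split; first by rewrite openE => y /cylinder_eq xy; exists F => //; rewrite xy.
move=> y /(_ (cylinder f F y)) []; first by exists F.
by move=> z [/cylinder_eq <- /cylinder_eq ->].
Qed.

Lemma pattern_zero_dim : injective f -> zero_dim_hausdorff X.
Proof.
move=> fI; split.
  move=> x y xy; apply: fI; apply/funext => i.
  have [||z [/(_ i erefl) <- /(_ i erefl)]//] :=
    xy (cylinder f [set i] x) (cylinder f [set i] y);
  by exists [set i] => //; exact: finite_set1.
exists [set U | exists F x, finite_set F /\ U = cylinder f F x]; split.
  split=> [_ [F [x [finF ->]]]|x A [F finF FA]].
    by have [] := cylinder_clopen x finF.
  by exists (cylinder f F x) => //; split=> //; exists F, x.
by move=> _ [F [x [finF ->]]]; exact: cylinder_clopen.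
Qed.

End PatternSpace.

Definition tower (s : cardseq) := {w : cs_len s & cs_term w}.

(** [g] is total but injective only above [w], which bounds the later terms without a subtype. Terms
    are nonempty because levels below the height are. *)
Definition bounded_tails (s : cardseq) := forall w : cs_len s,
  inhabited (cs_term w) /\
  ((forall v, ord_le v w) \/
   embeds nat (cs_term w) /\ exists g : tower s -> cs_term w -> bool,
     forall x y, ord_lt w (tag x) -> ord_lt w (tag y) -> g x = g y -> x = y).

(** * Order facts about ordinals *)

Lemma ord_ltNle (W : ordinal_type) (v w : W) : ord_lt v w <-> ~ ord_le w v.
Proof. by rewrite /ord_lt; split=> /negP. Qed.

Lemma ord_ltxx (W : ordinal_type) (w : W) : ~ ord_lt w w.
Proof. by move/ord_ltNle; apply; exact: ord_lexx. Qed.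

Lemma ord_le_trans (W : ordinal_type) (u v w : W) : ord_le u v -> ord_le v w -> ord_le u w.
Proof.
move=> uv vw.
have [|z [[/asboolP zA zlb] _]] := @ord_wo W (fun z => `[< z = u \/ z = v \/ z = w >]).
  by exists u; apply/asboolP; left.
have [zu zv zw] : [/\ ord_le z u, ord_le z v & ord_le z w].
  by split; apply: zlb; apply/asboolP; tauto.
case: zA => [<-|[zE|zE]]; first by [].
- by rewrite (@ord_le_anti _ u v) ?uv // -zE zu.
- by rewrite -(@ord_le_anti _ v w) // vw -zE zv.
Qed.

Lemma ord_lt_le (W : ordinal_type) (v w : W) : ord_lt v w -> ord_le v w.
Proof. by move=> /negbTE vw; have := ord_le_total v w; rewrite vw orbF. Qed.

Lemma ord_lt_le_trans (W : ordinal_type) (u v w : W) : ord_lt u v -> ord_le v w -> ord_lt u w.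
Proof.
by move=> /ord_ltNle uv vw; apply/ord_ltNle => wu; apply: uv; exact: ord_le_trans wu.
Qed.

Lemma ord_le_lt_trans (W : ordinal_type) (u v w : W) : ord_le u v -> ord_lt v w -> ord_lt u w.
Proof.
by move=> uv /ord_ltNle vw; apply/ord_ltNle => wu; apply: vw; exact: ord_le_trans uv.
Qed.

Lemma ord_lt_neq (W : ordinal_type) (v w : W) : ord_le v w -> v <> w -> ord_lt v w.
Proof.
by move=> vw nvw; apply/ord_ltNle => wv; apply: nvw; apply: ord_le_anti; rewrite vw wv.
Qed.

Lemma ord_min (W : ordinal_type) (A : set W) : A !=set0 ->
  exists2 w, A w & forall v, A v -> ord_le w v.
Proof.
move=> [x Ax]; have [|w [[/asboolP Aw wlb] _]] := @ord_wo W (fun z => `[< A z >]).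
  by exists x; apply/asboolP.
by exists w => // v Av; apply: wlb; apply/asboolP.
Qed.

(** * The 0-1 matrix on the tower and its levels *)

Section Realization.
Variables (s : cardseq) (P : forall w : cs_len s, cs_term w -> tower s -> bool).
Hypothesis P_dense : forall (w : cs_len s) (F : set (tower s)) (G : set (cs_term w))
    (p : tower s -> bool),
  (exists v, ord_lt w v) -> finite_set F -> finite_set G ->
  (forall x, F x -> ord_lt w (tag x)) ->
  exists z, ~ G z /\ forall x, F x -> P z x = p x.

Definition tower_pattern (x y : tower s) : bool :=
  if ord_lt (tag x) (tag y) then P (tagged x) y else `[< x = y >].

Local Notation X := (pattern_space tower_pattern).

Lemma tower_pattern_ge x y : ord_le (tag y) (tag x) -> tower_pattern x y -> x = y.
Proof. by rewrite /tower_pattern /ord_lt => -> /asboolP. Qed.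

Lemma tower_pattern_refl x : tower_pattern x x.
Proof.
by rewrite /tower_pattern; case: ifPn => [/ord_ltxx//|_]; apply/asboolP.
Qed.

(** The column of the lower of two points is an indicator at both of them, so it separates them. *)
Lemma tower_pattern_inj : injective tower_pattern.
Proof.
move=> x y xy; have [yx|yx] := orP (ord_le_total (tag y) (tag x)).
  by apply: tower_pattern_ge => //; rewrite xy tower_pattern_refl.
by symmetry; apply: tower_pattern_ge => //; rewrite -xy tower_pattern_refl.
Qed.

Lemma isolated_at_level (A : set X) (x : X) : A x ->
  (forall y, A y -> ord_le (tag x) (tag y)) -> isolated A x.
Proof.
move=> Ax xmin; split; first exact: mem_set.
exists (cylinder tower_pattern [set x] x).
  by exists [set x] => //; exact: finite_set1.
apply/seteqP; split=> [y [/(_ x erefl) yx Ay]|_ -> //].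
by apply: tower_pattern_ge; [exact: xmin|rewrite yx tower_pattern_refl].
Qed.

(** A point of least level in [A] is isolated by its own column. *)
Lemma tower_scattered : scattered X.
Proof.
move=> A [x0 Ax0].
have [|w [x [Ax xw]] wmin] := @ord_min _ [set w | exists x : X, A x /\ tag x = w].
  by exists (tag x0), x0.
exists x; apply: isolated_at_level => // y Ay; rewrite xw; apply: wmin.
by exists y.
Qed.

Lemma tower_limit (w : cs_len s) (x : X) (V : set X) :
  ord_lt w (tag x) -> nbhs x V -> exists z : cs_term w, V (Tagged _ z).
Proof.
move=> wx [F finF FV].
(* Independence settles the columns of [F] above [w]; the points to avoid are those of level [w]
   that are themselves columns in [F]. *)
have [||||z [zF zP]] := @P_dense w (F `&` [set y | ord_lt w (tag y)])
   ((fun z => (Tagged (@cs_term s) z)) @^-1` F) (fun y => tower_pattern x y).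
- by exists (tag x).
- exact: finite_setIl.
- by apply: finite_preimage => // y z _ _; exact: Tagged_inj.
- by move=> y [].
exists z; apply: FV => y Fy.
have [wy|wy] := boolP (ord_lt w (tag y)).
  by rewrite {1}/tower_pattern /= wy zP.
(* At a column [y] not above [w] both rows carry the indicator of [y], and both values are 0: [x]
   lies higher, and [z] is not in [F]. *)
have {}wy : ord_le (tag y) w by move: wy; rewrite /ord_lt negbK.
have yx := ord_le_lt_trans wy wx.
rewrite /tower_pattern /= /ord_lt wy /= (ord_lt_le yx) /=.
have -> : `[< x = y >] = false by apply/asboolP => xy; move: yx; rewrite xy => /ord_ltxx.
apply/asboolP => zy; apply: zF; by rewrite /preimage /= zy.
Qed.

(** Once the levels below [w] are removed, a point of level [w] is isolated by its own column, and
    every higher point is a limit of level [w]. *)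
Lemma tower_CB_level w : @CB_level X (cs_len s) w = [set x : X | tag x = w].
Proof.
elim/(well_founded_ind (@ord_lt_wf (cs_len s))): w => w IH; rewrite CB_levelE.
have -> : ~` (\bigcup_(v in [set v | ord_lt v w]) @CB_level X (cs_len s) v) =
    [set x : X | ord_le w (tag x)].
  apply/seteqP; split=> x /=.
    move=> xn; apply: contrapT => /ord_ltNle xw; apply: xn.
    by exists (tag x) => //; rewrite IH.
  by move=> wx [v /= vw]; rewrite IH// => xv; move: vw; rewrite -xv => /ord_ltNle.
apply/seteqP; split=> [x [/set_mem /= wx [V Vx VE]]|x /= xw]; last first.
  apply: isolated_at_level => [|y /=]; last by rewrite xw.
  by rewrite /= xw ord_lexx.
apply: contrapT => nxw; have {nxw}wx' : ord_lt w (tag x) by apply: ord_lt_neq => // /esym.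
have [z Vz] := tower_limit wx' Vx.
have : (V `&` [set x : X | ord_le w (tag x)]) (Tagged _ z).
  by split=> //=; exact: ord_lexx.
by rewrite VE => zx; move: wx'; rewrite -zx /= => /ord_ltxx.
Qed.

Lemma tower_is_CS : (forall w : cs_len s, inhabited (cs_term w)) -> is_CS s X.
Proof.
move=> inh; exists (cs_len s); split; last first.
  exists id; split => //=; first by exists id.
  move=> w; apply: embeds_anti.
    have zw (z : cs_term w) : Tagged (@cs_term s) z \in (@CB_level X (cs_len s) w).
      by apply: mem_set; rewrite tower_CB_level.
    exists (fun z => SigSub (zw z)) => z z' /(congr1 val) /=; exact: Tagged_inj.
  rewrite tower_CB_level.
  have toK (x : tower s) : tag x = w -> {z : cs_term w | Tagged (@cs_term s) z = x}.
    by case: x => v z /= <-; exists z.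
  exists (fun x : set_type [set x : X | tag x = w] => sval (toK _ (set_mem (valP x)))).
  move=> x y E; apply: val_inj.
  by rewrite -(svalP (toK _ (set_mem (valP x)))) E (svalP (toK _ (set_mem (valP y)))).
split=> [|w]; last first.
  by have [z] := inh w; exists (Tagged _ z); rewrite tower_CB_level.
apply/seteqP; split=> // x [/set_mem]; case.
by exists (tag x) => //; rewrite tower_CB_level.
Qed.

End Realization.

Lemma bounded_tails_realized s : bounded_tails s ->
  exists X : topologicalType, [/\ zero_dim_hausdorff X, scattered X & is_CS s X].
Proof.
move=> sb.
have dense w : {P : cs_term w -> tower s -> bool |
    forall (F : set (tower s)) (G : set (cs_term w)) (p : tower s -> bool),
      (exists v, ord_lt w v) -> finite_set F -> finite_set G ->
      (forall x, F x -> ord_lt w (tag x)) ->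
      exists z, ~ G z /\ forall x, F x -> P z x = p x}.
  apply/cid; have [_ [wmax|[winf [g gI]]]] := sb w.
    (* At the last index no column lies higher, so any family will do. *)
    by exists (fun _ _ => true) => F G p [v /ord_ltNle]; rewrite wmax.
  have [P PP] := independent_family (S := fun x => ord_lt w (tag x)) winf gI.
  by exists P => F G p _ finF finG FS; exact: PP.
pose P w := sval (dense w); have PP w := svalP (dense w).
exists (pattern_space (tower_pattern P)); split.
- exact/pattern_zero_dim/tower_pattern_inj.
- exact: tower_scattered.
- by apply: tower_is_CS => // w; have [] := sb w.
Qed.

(** * Levels of regular scattered spaces *)

Lemma bounded_tails_eq s t : cardseq_eq s t -> bounded_tails t -> bounded_tails s.
Proof.
move=> [f [/bij_inj fI fmono fcard]] tb w; have [[z] bw] := tb (f w).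
have ltf u v : ord_lt (f u) (f v) = ord_lt u v by rewrite /ord_lt fmono.
have [[_ _] [e' eI']] := card_eq_embeds (fcard w).
split; first by split; exact: e' z.
case: bw => [wmax|[winf [g gI]]]; first by left=> v; rewrite -fmono.
right; split; first by apply: embeds_trans winf _; exists e'.
have /(_ _)/cid-/all_sig[e eI] v : embeds (cs_term v) (cs_term (f v)).
  by have [] := card_eq_embeds (fcard v).
have [h hI] := embeds_pow (ex_intro _ e' eI').
exists (fun x => h (g (Tagged (@cs_term t) (e _ (tagged x))))) => -[u x] [v y] /= wu wv.
move=> /hI/gI; rewrite !ltf => /(_ wu wv) E.
have uv : u = v by apply: fI; exact: (congr1 tag E).
case: _ / uv y wv E => y _ E; congr existT; apply: eI.
exact: Tagged_inj E.
Qed.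

Section RegularScattered.
Variables (X : topologicalType) (W : ordinal_type).
Local Notation level := (@CB_level X W).
Local Notation above := (fun w : W => ~` \bigcup_(v in [set v | ord_lt v w]) level v).

Lemma CB_level_above v w : ord_le w v -> level v `<=` above w.
Proof.
move=> wv x; rewrite CB_levelE => /isolatedS xv [u /= uw ux]; apply: xv.
by exists u => //=; exact: ord_lt_le_trans wv.
Qed.

Lemma CB_level_disjoint v w x : level v x -> level w x -> v = w.
Proof.
have lt u u' : level u x -> level u' x -> ord_le u u'.
  move=> ux u'x; apply: contrapT => /ord_ltNle uu'.
  by apply: (CB_level_above (ord_lexx u) ux); exists u'.
by move=> vx wx; apply: ord_le_anti; rewrite !lt.
Qed.

Hypotheses (Xscat : scattered X) (Xreg : regular_space X).

(** An isolated point of the trace of the open set [V^°] on [above w] is isolated in [above w]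
    itself. *)
Lemma CB_level_dense v w x V : ord_le w v -> level v x -> nbhs x V ->
  V `&` level w !=set0.
Proof.
move=> wv vx Vx.
have [|p [/set_mem[Vp Yp] [U Up UE]]] := Xscat (A := V^° `&` above w).
  by exists x; split; [exact: Vx|exact: CB_level_above vx].
exists p; split; first exact: interior_subset.
rewrite CB_levelE; split; first exact: mem_set.
exists (U `&` V^°); last by rewrite -setIA.
by apply: filterI => //; exact: nbhs_interior.
Qed.

(** Regularity shrinks an isolating neighbourhood to one whose closure lies inside it. *)
Lemma CB_level_separate v x : level v x ->
  exists2 V, nbhs x V & closure V `&` above v `<=` [set x].
Proof.
rewrite CB_levelE => -[_ [U Ux <-]]; have [V Vx VU] := Xreg Ux.
by exists V => //; exact: setSI.
Qed.

(* The traces on the dense level w of the neighbourhoods V_x with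
   [closure V_x `&` above v = [set x]] determine x. *)
Lemma CB_tail_embeds w : exists g : tower (CB_cardseq X W) -> level w -> bool,
  forall x y, ord_lt w (tag x) -> ord_lt w (tag y) -> g x = g y -> x = y.
Proof.
have sep (x : tower (CB_cardseq X W)) : {V | nbhs (val (tagged x)) V &
    closure V `&` above (tag x) `<=` [set val (tagged x)]}.
  by apply/cid2/CB_level_separate/set_mem/valP.
pose V x := s2val (sep x).
have Vnbhs (x : tower (CB_cardseq X W)) : nbhs (val (tagged x)) (V x) := s2valP (sep x).
have Vsep (x : tower (CB_cardseq X W)) : closure (V x) `&` above (tag x) `<=`
    [set val (tagged x)] := s2valP' (sep x).
exists (fun x d => `[< V x (val d) >]).
(* When the traces agree, the point of [y] is in the closure of [V x]: near it, level [w] meets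
   [V y], hence [V x]. Then [Vsep] identifies the two points. *)
have sub (x y : tower (CB_cardseq X W)) : ord_lt w (tag y) -> ord_le (tag x) (tag y) ->
    (forall d : level w, `[< V x (val d) >] = `[< V y (val d) >]) ->
    val (tagged y) = val (tagged x).
  move=> wy xy Vxy; have ly : level (tag y) (val (tagged y)) := set_mem (valP (tagged y)).
  apply: Vsep; split; last exact: CB_level_above ly.
  move=> O Oy.
  have [d [[Od Vd] ld]] := CB_level_dense (ord_lt_le wy) ly (filterI Oy (Vnbhs y)).
  exists d; split=> //; apply/asboolP.
  by rewrite (Vxy (SigSub (mem_set ld))); apply/asboolP.
move=> x y wx wy E.
have Exy d : `[< V x (val d) >] = `[< V y (val d) >] := congr1 (fun h => h d) E.
have {E} : val (tagged x) = val (tagged y).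
  by have [xy|yx] := orP (ord_le_total (tag x) (tag y)); [symmetry|]; apply: sub.
(* Equal points lie on the same level, so the tags agree too. *)
have := CB_level_disjoint (set_mem (valP (tagged x))).
case: x y {wx wy Exy} => [u x] [v y] /= + xy; rewrite xy.
move=> /(_ _ (set_mem (valP y))) uv; case: _ / uv y xy => y /val_inj->.
by [].
Qed.

End RegularScattered.

Lemma regular_bounded_tails s (X : topologicalType) :
  regular_hausdorff X -> scattered X -> is_CS s X -> bounded_tails s.
Proof.
move=> [Xhaus Xreg] Xscat [W [[_ Wne] /bounded_tails_eq]]; apply=> w.
split; first by have [x wx] := Wne w; split; exact: (SigSub (mem_set wx)).
have [wmax|nmax] := pselect (forall v, ord_le v w); first by left.
right; split; last exact: CB_tail_embeds.
have [v wv] : exists v, ord_lt w v.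
  by apply: contrapT => nv; apply: nmax => v; apply: contrapT => /ord_ltNle wv; apply: nv; exists v.
apply/infinite_embeds => /= finD.
have {}finD : finite_set (@CB_level X W w).
  by rewrite (eq_finite_set (card_setT_sym _)).
have Dclosed := accessible_finite_set_closed.1 (hausdorff_accessible Xhaus) _ finD.
have [x vx] := Wne v.
have wx : @CB_level X W w x.
  apply: Dclosed => V Vx; rewrite setIC.
  exact: (CB_level_dense Xscat (ord_lt_le wv) vx).
by move: wv; rewrite (CB_level_disjoint vx wx) => /ord_ltxx.
Qed.

Lemma zero_dim_regular (X : topologicalType) : zero_dim_hausdorff X -> regular_hausdorff X.
Proof.
move=> [Xhaus [B [[Bo Bbase] Bclopen]]]; split=> // x A /Bbase[U [BU Ux] UA].
have [Uo Uc] := Bclopen _ BU; exists U; first exact: open_nbhs_nbhs.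
by rewrite -(closure_id U).1.
Qed.

(** * Cardinal sequences *)

(** [bounded_tails] without the exception for the last index: what holds of a concatenation before a
    finite term is appended. *)
Definition infinite_tails (s : cardseq) := forall w : cs_len s,
  embeds nat (cs_term w) /\ exists g : tower s -> cs_term w -> bool,
    forall x y, ord_lt w (tag x) -> ord_lt w (tag y) -> g x = g y -> x = y.

Lemma cs_cat_ltE s t (x y : cs_len s + cs_len t) :
  @ord_lt (cs_len (cs_cat s t)) x y =
  match x, y with
  | inl a, inl b => ord_lt a b
  | inl _, inr _ => true
  | inr _, inl _ => false
  | inr a, inr b => ord_lt a b
  end.
Proof. by case: x y => [a|a] [b|b]. Qed.

Definition tower_split s t (x : tower (cs_cat s t)) : tower s + tower t :=
  match x with
  | existT (inl i) z => inl (existT _ i z)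
  | existT (inr j) z => inr (existT _ j z)
  end.

Lemma tower_split_inj s t : injective (@tower_split s t).
Proof.
pose g (x : tower s + tower t) : tower (cs_cat s t) :=
  match x with
  | inl (existT i z) => existT _ (inl i) z
  | inr (existT j z) => existT _ (inr j) z
  end.
have gK : cancel (@tower_split s t) g by move=> [[i|j] z].
exact: can_inj gK.
Qed.

Lemma embeds_inhabited X : embeds nat X -> inhabited X.
Proof. by move=> [e _]; split; exact: e 0. Qed.

(** An index [i] of [s] has at most 2^K points above it, and [K] embeds in its term; an index of [t]
    has only points of [t] above it. *)
Lemma infinite_tails_cat K s t : embeds nat K ->
  (forall i : cs_len s, embeds K (cs_term i)) ->
  embeds (tower s) (K -> bool) -> embeds (tower t) (K -> bool) ->
  infinite_tails t ->
  infinite_tails (cs_cat s t) /\ embeds (tower (cs_cat s t)) (K -> bool).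
Proof.
move=> Kinf Ks sK tK tinf.
have stK : embeds (tower (cs_cat s t)) (K -> bool).
  apply: embeds_trans (embeds_sum_pow Kinf sK tK).
  by exists (@tower_split s t); exact: tower_split_inj.
split=> // -[i|j] /=.
  split; first exact: embeds_trans (Ks i).
  have [g gI] := embeds_trans stK (embeds_pow (Ks i)).
  by exists g => x y _ _ /gI.
have [jinf [g gI]] := tinf j; split=> //.
exists (fun x => if tower_split x is inr y then g y else fun=> true).
move=> x y jx jy E; apply: tower_split_inj.
case: x y jx jy E => [[i|i] z] [[i'|i'] z'] //=; rewrite !cs_cat_ltE// => ji ji'.
by move=> /gI -> //.
Qed.

Lemma in_S_tower K s : embeds nat K -> in_S K s ->
  (forall i : cs_len s, embeds K (cs_term i)) /\ embeds (tower s) (K -> bool).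
Proof.
move=> Kinf [[W [[_ Wseg] [w [f [fmono fE]]]] _ sK]].
split=> [i|]; first by apply/embedsP; have [] := sK i.
apply: embeds_sigma_pow => // [|i]; last by apply/embedsP; have [] := sK i.
have fI : injective f by move=> x y fxy; apply: ord_le_anti; rewrite -!fmono fxy ord_lexx.
(* The length is a proper initial segment of the successor of 2^K, so it has at most 2^K
   elements. *)
apply/embedsP; apply: card_le_trans (Wseg w); rewrite -fE.
have : range f #= [set: cs_len s] by apply: inj_card_eq => ? ? _ _; exact: fI.
by rewrite card_eq_le => /andP[].
Qed.

Lemma cardinal_lt_embeds K L : cardinal_lt K L <-> ~ embeds L K.
Proof.
split=> [[/embedsP KL /negP KnL] LK|LK].
  by apply: KnL; exact: embeds_anti.
have [KL|//] := embeds_total K L; split; first exact/embedsP.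
by apply/negP => /card_eq_embeds[].
Qed.

(** The second conclusion carries the induction: applied to the remaining blocks with [K] the first
    cardinal, it bounds everything after the first block. *)
Lemma infinite_tails_concat m (kappa : 'I_m -> cardinal) (t : 'I_m -> cardseq) :
  (forall i, embeds nat (kappa i)) ->
  (forall i j : 'I_m, (i < j)%N -> cardinal_lt (kappa j) (kappa i)) ->
  (forall i, in_S (kappa i) (t i)) ->
  infinite_tails (cs_concat t) /\
  forall K, embeds nat K -> (forall i, embeds (kappa i) K) ->
    embeds (tower (cs_concat t)) (K -> bool).
Proof.
elim: m kappa t => [|m IH] kappa t kinf kdec kS.
  by split=> [[]//|K _ _]; exists (fun=> fun=> true) => -[[]].
have [|||tinf tK] := IH (fun i => kappa (lift ord0 i)) (fun i => t (lift ord0 i)).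
- by move=> i; exact: kinf.
- by move=> i j ij; apply: kdec; rewrite /= /bump /= !add1n.
- by move=> i; exact: kS.
have {}tK := tK (kappa ord0) (kinf ord0).
have [sK0 sK] := in_S_tower (kinf ord0) (kS ord0).
have [|cinf cK] := infinite_tails_cat (kinf ord0) sK0 sK (tK _) tinf.
  by move=> i; apply/embedsP; have [] := kdec ord0 (lift ord0 i) isT.
split=> // K Kinf kK; apply: embeds_trans cK _; exact: embeds_pow.
Qed.

Lemma infinite_bounded_tails s : infinite_tails s -> bounded_tails s.
Proof.
move=> sinf w; have [winf wg] := sinf w; split; first exact: embeds_inhabited.
by right.
Qed.

(** A finite term embeds in each infinite term; the constant first components keep its points apart
    from those of [s]. *)
Lemma bounded_tails_rcons s n : (0 < n)%N ->
  infinite_tails s -> bounded_tails (cs_cat s (cs_singleton 'I_n)).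
Proof.
case: n => // n _ sinf [i|[]] /=; last by split; [split; exact: ord0|left=> -[]].
have [iinf [g gI]] := sinf i; split; first exact: embeds_inhabited.
right; split=> //; have [p pI] := embeds_pow_square iinf.
have [e eI] : embeds (tower (cs_singleton 'I_n.+1)) (cs_term i -> bool).
  apply: (@embeds_trans 'I_n.+1); first by exists (fun x => tagged x) => -[[] x] [[] y] /= ->.
  apply: embeds_trans (embeds_powS _); apply: embeds_trans iinf.
  by exists val; exact: val_inj.
have [c _] := iinf.
have tf : (fun _ : cs_term i => true) <> (fun=> false) by move/(congr1 (fun h => h (c 0))).
exists (fun x => match tower_split x with
  | inl y => p (fun=> true, g y) | inr y => p (fun=> false, e y) end).
move=> x y ix iy E; apply: (@tower_split_inj s (cs_singleton 'I_n.+1)).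
case: x y ix iy E => [[u|u] z] [[u'|u'] z'] ix iy /=.
- by move=> /pI[/gI -> //].
- by move=> /pI[/tf].
- by move=> /pI[/esym/tf].
- by move=> /pI[/eI ->].
Qed.

(** * Suborders, successor cardinals and comparison of ordinals *)

Lemma pullback_wo (T : Type) (W : ordinal_type) (f : T -> W) : injective f ->
  well_order (fun x y => ord_le (f x) (f y)).
Proof.
move=> fI; apply: antisymmetric_well_order => [x y /ord_le_anti/fI//|A [x xA]].
have [|_ [y yA <-] ymin] := @ord_min W [set w | exists2 y, y \in A & f y = w].
  by exists (f x), x.
by exists y; split=> // z zA; apply: ymin; exists z.
Qed.

Definition ord_sub (W : ordinal_type) (A : set W) : ordinal_type :=
  OrdinalType (pullback_wo (f := @sval W A) (@eq_sig_hprop _ _ (fun _ => @Prop_irrelevance _))).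

Lemma cantor_embeds K : ~ embeds (K -> bool) K.
Proof.
move=> /embeds_surj-/(_ (fun=> true))[g gS].
have [k] := gS (fun k => ~~ g k k).
by move/(congr1 (fun h => h k)); case: (g k k).
Qed.

Lemma card_le_subP (T : Type) (A : set T) K : (A #<= [set: K]) <-> embeds {x | A x} K.
Proof.
rewrite -(card_le_eql (card_setT A)) embedsP; split; apply: embeds_trans.
  exists (fun x => SigSub (mem_set (svalP x)) : A) => x y /(congr1 val) /= xy.
  exact: eq_sig_hprop xy.
exists (fun x => exist A (val x) (set_mem (valP x))) => x y /(congr1 sval) /=.
exact: val_inj.
Qed.

(** Well-order the power set of [K], which exceeds [K] by Cantor. Unless it already works, take the
    segment below the least [w] whose segment exceeds [K]. *)
Lemma succ_cardinal_exists K : exists W, is_succ_cardinal K W.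
Proof.
have [R Rwo] := well_ordering_principle {classic (K -> bool)}.
pose W0 := OrdinalType Rwo.
have [seg|nseg] := pselect (forall w : W0, [set v | ord_lt v w] #<= [set: K]).
  by exists W0; split=> // /embedsP/cantor_embeds.
have [|w wK wmin] := @ord_min W0 [set w | ~ ([set v | ord_lt v w] #<= [set: K])].
  by apply/existsNP.
exists (ord_sub [set v | ord_lt v w]); split.
  move=> wK'; apply: wK; exact/card_le_subP/embedsP.
move=> [v vw]; have : [set u | ord_lt u v] #<= [set: K].
  by apply: contrapT => /wmin; move/ord_ltNle: vw.
rewrite !card_le_subP; apply: embeds_trans.
exists (fun x => exist (fun u => ord_lt u v) (sval (sval x)) (svalP x)).
by move=> x y /(congr1 sval) /= xy; do 2 apply: eq_sig_hprop => //.
Qed.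

(* Send v to the least element of W not yet used; the range is an initial
   segment of W, a proper one because W does not embed in V. *)
Lemma ordinal_lt_card (V W : ordinal_type) : ~ embeds W V -> ordinal_lt V W.
Proof.
move=> nWV.
have free (v : V) (r : forall u, ord_lt u v -> W) : exists w, forall u uv, r u uv <> w.
  apply: contrapT => nw; apply: nWV.
  have H w : exists x : {u | ord_lt u v}, r _ (proj2_sig x) = w.
    apply: contrapT => nx; apply: nw; exists w => u uv ruv; apply: nx.
    by exists (exist _ u uv).
  have [h hP] := choice H; exists (fun w => sval (h w)) => w w' hw.
  have hE : h w = h w' by exact: eq_sig_hprop hw.
  by rewrite -(hP w) -(hP w') hE.
pose next v r := ord_min (free v r).
pose f := Fix (@ord_lt_wf V) (fun=> W) (fun v r => s2val (cid2 (next v r))).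
have fE v : (forall u, ord_lt u v -> f u <> f v) /\
    forall w, (forall u, ord_lt u v -> f u <> w) -> ord_le (f v) w.
  have -> : f v = s2val (cid2 (next v (fun u _ => f u))).
    rewrite {1}/f Fix_eq // => [v' r r' rr']; suff -> : r = r' by [].
    by apply: functional_extensionality_dep => u; apply/funext.
  case: cid2 => w /= wfree wmin; split=> [u uv|w' w'free]; first exact: wfree.
  exact: wmin.
have flt u v : ord_lt u v -> ord_lt (f u) (f v).
  move=> uv; apply: ord_lt_neq; last exact: (fE v).1.
  apply: (fE u).2 => x xu; apply: (fE v).1; exact: ord_lt_le_trans xu (ord_lt_le uv).
have fmono : {mono f : x y / ord_le x y}.
  move=> x y; apply/idP/idP => [fxy|xy].
    by apply: contrapT => /ord_ltNle/flt/ord_ltNle; apply.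
  have [->|nxy] := pselect (x = y); first exact: ord_lexx.
  by apply/ord_lt_le/flt/ord_lt_neq.
have [|w nw wmin] := @ord_min W (~` range f).
  apply: contrapT => nw; apply: nWV.
  have H w : exists v, f v = w.
    by apply: contrapT => nv; apply: nw; exists w => -[v _ fv]; apply: nv; exists v.
  by have [h hP] := choice H; exists h => x y; rewrite -{2}(hP x) -{2}(hP y) => ->.
exists w, f; split=> //; apply/seteqP; split=> [_ [v _ <-]|x /= /ord_ltNle xw].
  apply: ord_lt_neq => [|fv]; last by apply: nw; exists v.
  by apply: (fE v).2 => u _ fu; apply: nw; exists u.
by apply: contrapT => nx; apply: xw; exact: wmin.
Qed.

(** * Isomorphism, concatenation and restriction of cardinal sequences *)

Lemma cardseq_eqI s t (f : cs_len s -> cs_len t) :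
  {mono f : x y / ord_le x y} -> (forall y, exists x, f x = y) ->
  (forall i, [set: cs_term i] #= [set: cs_term (f i)]) -> cardseq_eq s t.
Proof.
move=> fmono /choice[g fK] fcard; exists f; split=> //; exists g => // x.
by apply: ord_le_anti; rewrite -!fmono !fK ord_lexx.
Qed.

Lemma cardseq_eq_sym s t : cardseq_eq s t -> cardseq_eq t s.
Proof.
move=> [f [[g fK gK] fmono fcard]]; apply: (cardseq_eqI (f := g)) => [x y|y|i].
- by rewrite -fmono !gK.
- by exists (f y).
- by have := fcard (g i); rewrite gK card_eq_sym.
Qed.

Lemma cardseq_eq_trans s t r : cardseq_eq s t -> cardseq_eq t r -> cardseq_eq s r.
Proof.
move=> [f [fb fmono fcard]] [g [gb gmono gcard]]; exists (g \o f); split.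
- exact: bij_comp.
- by move=> x y /=; rewrite gmono fmono.
- by move=> i; exact: card_eq_trans (fcard i) (gcard _).
Qed.

Lemma cs_cat_eqr s t r : cardseq_eq t r -> cardseq_eq (cs_cat s t) (cs_cat s r).
Proof.
move=> [f [[g _ gK] fmono fcard]].
apply: (@cardseq_eqI (cs_cat s t) (cs_cat s r)
  (fun x => match x with inl a => inl a | inr b => inr (f b) end)).
- by move=> [x|x] [y|y] //=.
- by move=> [x|x]; [exists (inl x)|exists (inr (g x)); rewrite gK].
- by move=> [x|x] //=.
Qed.

Lemma cs_catA s t r : cardseq_eq (cs_cat s (cs_cat t r)) (cs_cat (cs_cat s t) r).
Proof.
apply: (@cardseq_eqI (cs_cat s (cs_cat t r)) (cs_cat (cs_cat s t) r)
  (fun x => match x with inl a => inl (inl a) | inr (inl b) => inl (inr b)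
            | inr (inr c) => inr c end)).
- by move=> [x|[x|x]] [y|[y|y]].
- by move=> [[x|x]|x]; [exists (inl x)|exists (inr (inl x))|exists (inr (inr x))].
- by move=> [x|[x|x]] /=.
Qed.

Definition cs_restr (s : cardseq) (A : set (cs_len s)) : cardseq :=
  @CardSeq (ord_sub A) (fun w => cs_term (sval w)).

Lemma cs_restr_setT s (A : set (cs_len s)) : (forall w, A w) -> cardseq_eq s (cs_restr A).
Proof.
move=> AT; apply: (@cardseq_eqI s (cs_restr A) (fun w => exist A w (AT w))) => //.
by move=> [w Aw]; exists w; exact: eq_sig_hprop.
Qed.

Lemma cs_restr_cat s (C A B : set (cs_len s)) : C = A `|` B ->
  (forall v w, A v -> B w -> ord_lt v w) ->
  cardseq_eq (cs_restr C) (cs_cat (cs_restr A) (cs_restr B)).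
Proof.
move=> -> AB; apply: cardseq_eq_sym.
apply: (@cardseq_eqI (cs_cat (cs_restr A) (cs_restr B)) (cs_restr (A `|` B))
  (fun x => match x with
   | inl a => exist _ (sval a) (or_introl (svalP a))
   | inr b => exist _ (sval b) (or_intror (svalP b)) end)).
- move=> [[x Ax]|[x Bx]] [[y Ay]|[y By]] //=.
    by rewrite ord_lt_le//; exact: AB.
  by apply/negbTE; exact: AB.
- move=> [x [Ax|Bx]]; [exists (inl (exist _ x Ax))|exists (inr (exist _ x Bx))].
    exact: eq_sig_hprop.
  exact: eq_sig_hprop.
- by move=> [[x Ax]|[x Bx]] /=.
Qed.

(** The predicate [L] bounds the cardinals of the blocks, so that a new first block can be prepended
    with the cardinals still strictly decreasing. *)
Definition decomposed (s : cardseq) (L : cardinal -> Prop) : Prop :=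
  exists (m : nat) (kappa : 'I_m -> cardinal) (t : 'I_m -> cardseq),
    [/\ forall i, infinite_set [set: kappa i] /\ L (kappa i),
        forall i j : 'I_m, (i < j)%N -> cardinal_lt (kappa j) (kappa i),
        forall i, in_S (kappa i) (t i) &
        cardseq_eq s (cs_concat t) \/
        exists n : nat, (0 < n)%N /\
          cardseq_eq s (cs_cat (cs_concat t) (cs_singleton 'I_n))].

Lemma decomposed_nil s L : (cs_len s -> False) -> decomposed s L.
Proof.
move=> s0; exists 0, (fun _ => void), (fun _ => cs_nil); split; try by move=> [].
left; apply: (@cardseq_eqI s cs_nil (fun x => match s0 x with end)).
- by move=> x; case: (s0 x).
- by case.
- by move=> x; case: (s0 x).
Qed.

Lemma decomposed_cons K s t r (L : cardinal -> Prop) :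
  infinite_set [set: K] -> L K -> (forall J, cardinal_lt J K -> L J) ->
  in_S K t -> decomposed r (fun J => cardinal_lt J K) ->
  cardseq_eq s (cs_cat t r) -> decomposed s L.
Proof.
move=> Kinf LK Llt tS [m [kappa [u [kL kdec uS req]]]] seq.
exists m.+1, (fun i => if unlift ord0 i is Some j then kappa j else K),
  (fun i => if unlift ord0 i is Some j then u j else t); split.
- move=> i; case: unliftP => [j|] _ //; have [? ?] := kL j; split=> //; exact: Llt.
- move=> i j; case: (unliftP ord0 j) => [j' ->|->]; last by rewrite ltn0.
  case: (unliftP ord0 i) => [i' ->|_ _]; last by have [] := kL j'.
  by rewrite /= /bump /= !add1n ltnS; exact: kdec.
- by move=> i; case: unliftP => [j|] _.
rewrite /= unlift_none.
have -> : (fun i => if unlift ord0 (lift ord0 i) is Some j then u j else t) = u.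
  by apply/funext => i; rewrite liftK.
case: req => [ru|[n [n0 ru]]]; [left|right; exists n; split=> //].
  exact/(cardseq_eq_trans seq)/cs_cat_eqr.
apply: (cardseq_eq_trans seq); apply: cardseq_eq_trans (cs_catA _ _ _).
exact: cs_cat_eqr.
Qed.

(** * Cutting a sequence into blocks *)

Section Decomposition.
Variable s : cardseq.
Hypothesis sb : bounded_tails s.
Local Notation W := (cs_len s).
Local Notation K := (@cs_term s).
Local Notation from := (fun w => [set v : W | ord_le w v]).

(** The tail embedding at [w] bounds each later term and, after choosing a point in every term, also
    the number of indices. *)
Lemma from_in_S w (A : set W) : embeds nat (K w) -> A w -> A `<=` from w ->
  (forall v, A v -> embeds (K w) (K v)) -> in_S (K w) (cs_restr A).
Proof.
move=> winf Aw Aw_ge Abig.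
have [p pI] := embeds_pow_square winf.
have [e eI] := embeds_powS (K w).
have [g gI] : exists g : tower s -> K w -> bool,
    forall x y, ord_lt w (tag x) -> ord_lt w (tag y) -> g x = g y -> x = y.
  have [_ [wmax|[_ //]]] := sb w; exists (fun=> fun=> true) => x y.
  by move=> /ord_ltNle; rewrite wmax.
have inh v : K v by have [/inhabited_witness] := sb v.
have [c _] := winf.
have tf : (fun _ : K w => true) <> (fun=> false) by move/(congr1 (fun h => h (c 0))).
split.
- have [S Ssucc] := succ_cardinal_exists (K w -> bool); exists S; split=> //.
  apply: ordinal_lt_card => /= SA; case: Ssucc => nS _; apply: nS; apply/embedsP.
  apply: embeds_trans SA _.
  (* [g] is injective only above [w], so [w] itself gets its own flag. *)
  exists (fun v => if pselect (sval v = w) then p (fun=> true, fun=> true)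
                   else p (fun=> false, g (Tagged K (inh (sval v))))).
  move=> [u Au] [v Av] /= E; apply: eq_sig_hprop => //=; move: E.
  have lt x : A x -> x <> w -> ord_lt w x.
    by move=> /Aw_ge wx nx; apply: ord_lt_neq => // /esym.
  case: pselect => [uw|nu]; case: pselect => [vw|nv] /=; first by rewrite uw vw.
  + by move=> /pI[/tf].
  + by move=> /pI[/esym/tf].
  + by move=> /pI[/gI] /(_ (lt _ Au nu) (lt _ Av nv)) /(congr1 tag).
- by exists (exist A w Aw); split=> //= -[v Av]; exact: Aw_ge.
move=> [v Av] /=; rewrite !embedsP; split; first exact: Abig.
have [->|nvw] := pselect (v = w); first exact: embeds_powS.
exists (fun z => g (Tagged K z)) => z z' /gI.
have wv : ord_lt w v by apply: ord_lt_neq; [exact: Aw_ge|exact/nesym].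
by move=> /(_ wv wv); exact: Tagged_inj.
Qed.

(** Take a counterexample [u] with least cardinal [K u]. If it is finite, [u] is last; otherwise the
    first block [A] runs until a term drops below [K u], and the rest [B] starts with a smaller
    cardinal, so it decomposes. *)
Lemma from_decomposed w : decomposed (cs_restr (from w)) (fun J => embeds J (K w)).
Proof.
apply: contrapT => nw.
have [[u nu] /= umin] := min_card_family
  (fun x : {v | ~ decomposed (cs_restr (from v)) (fun J => embeds J (K v))} => K (sval x))
  (exist _ w nw).
have {umin}IH v : cardinal_lt (K v) (K u) ->
    decomposed (cs_restr (from v)) (fun J => embeds J (K v)).
  by move=> /cardinal_lt_embeds vu; apply: contrapT => nv; apply: vu; exact: (umin (exist _ v nv)).
apply: nu; have [[n Kn]|uinf] := pselect (finite_set [set: K u]).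
  have n0 : (0 < n)%N.
    rewrite lt0n; apply/eqP => n0; have [[z] _] := sb u.
    by move: Kn; rewrite n0 II0 card_eq0 => /eqP/(congr1 (fun A => A z)) /= => <-.
  exists 0, (fun _ => void), (fun _ => cs_nil); split; try by move=> [].
  right; exists n; split=> //.
  have umax v : ord_le v u.
    by have [_ [//|[/infinite_embeds []]]] := sb u; exists n.
  apply: (@cardseq_eqI (cs_restr (from u)) (cs_cat cs_nil (cs_singleton 'I_n)) (fun=> inr tt)).
  - move=> [x /= ux] [y /= uy] /=; symmetry; exact: ord_le_trans uy.
  - by case=> [[]|[]]; exists (exist _ u (ord_lexx u)).
  - move=> [x /= ux] /=.
    have <- : u = x by apply: ord_le_anti; rewrite ux umax.
    exact: card_eq_trans Kn card_II.
pose A := [set v | ord_le u v /\ forall x, ord_le u x -> ord_le x v -> embeds (K u) (K x)].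
pose B := [set v | ord_le u v /\ exists x, [/\ ord_le u x, ord_le x v & ~ embeds (K u) (K x)]].
have AB : from u = A `|` B.
  apply/seteqP; split=> [v /= uv|v [[]|[]]//].
  have [[x [ux xv nx]]|nx] :=
    pselect (exists x, [/\ ord_le u x, ord_le x v & ~ embeds (K u) (K x)]).
    by right; split=> //; exists x.
  by left; split=> // x ux xv; apply: contrapT => nux; apply: nx; exists x.
have ABlt v x : A v -> B x -> ord_lt v x.
  move=> [uv vA] [ux [y [uy yx ny]]]; apply/ord_ltNle => xv; apply: ny.
  by apply: vA => //; exact: ord_le_trans xv.
apply: (decomposed_cons (K := K u) _ _ _ _ _ (cs_restr_cat AB ABlt)) => //.
- exact: embeds_refl.
- by move=> J [/embedsP].
- apply: from_in_S; first exact/infinite_embeds.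
  + split; first exact: ord_lexx.
    move=> x ux xu; suff -> : x = u by exact: embeds_refl.
    by apply: ord_le_anti; rewrite xu ux.
  + by move=> v [].
  + by move=> v [uv]; apply=> //; exact: ord_lexx.
have [[v0 Bv0]|B0] := pselect (exists v, B v); last first.
  by apply: decomposed_nil => -[v Bv]; apply: B0; exists v.
have [|v [uv [x [ux xv nx]]] vmin] := @ord_min W B; first by exists v0.
(* The drop [x] that puts [v] in [B] is itself in [B], so the least index of [B] is a drop. *)
have vx : v = x.
  apply: ord_le_anti; rewrite xv andbT; apply: vmin; split=> //.
  by exists x; split=> //; exact: ord_lexx.
have -> : B = from v.
  apply/seteqP; split=> y; first exact: vmin.
  by move=> vy; split; [exact: ord_le_trans vy|exists x; rewrite -vx; split=> //; rewrite vx].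
have vu : cardinal_lt (K v) (K u) by apply/cardinal_lt_embeds; rewrite vx.
have [m [kappa [t [kL kdec tS teq]]]] := IH v vu.
exists m, kappa, t; split=> // i; have [kinf kv] := kL i; split=> //.
(* The cardinals of the rest embed in [K v], which is strictly below [K u]. *)
by apply/cardinal_lt_embeds => uk; rewrite vx in kv; apply: nx; exact: embeds_trans kv.
Qed.

End Decomposition.

Lemma bounded_tails_decomposed s : bounded_tails s -> decomposed s (fun=> True).
Proof.
move=> sb; have [[w0 _]|s0] := pselect (exists w : cs_len s, True); last first.
  by apply: decomposed_nil => w; apply: s0; exists w.
have [|w _ wmin] := @ord_min (cs_len s) setT; first by exists w0.
have [m [kappa [t [kL kdec tS teq]]]] := from_decomposed sb w.
exists m, kappa, t; split=> // [i|]; first by have [] := kL i.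
have sw := @cs_restr_setT s [set v | ord_le w v] (fun v => wmin v I).
by case: teq => [H|[n [n0 H]]]; [left|right; exists n; split=> //]; exact: cardseq_eq_trans H.
Qed.

Theorem theorem3p2 (s : cardseq) :
  [<-> exists X : topologicalType,
         [/\ regular_hausdorff X, scattered X & is_CS s X];
       exists X : topologicalType,
         [/\ zero_dim_hausdorff X, scattered X & is_CS s X];
       exists (m : nat) (kappa : 'I_m -> cardinal) (t : 'I_m -> cardseq),
         [/\ forall i, infinite_set [set: kappa i],
             forall i j : 'I_m, (i < j)%N -> cardinal_lt (kappa j) (kappa i),
             forall i, in_S (kappa i) (t i) &
             cardseq_eq s (cs_concat t) \/
             exists n : nat, (0 < n)%N /\
               cardseq_eq s (cs_cat (cs_concat t) (cs_singleton 'I_n))]].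
Proof.
have zero_dim_of_bounded := @bounded_tails_realized s.
tfae.
- by move=> [X [Xreg Xscat XCS]]; apply: zero_dim_of_bounded; exact: regular_bounded_tails XCS.
- move=> [X [/zero_dim_regular Xreg Xscat XCS]].
  have [m [kappa [t [kinf kdec tS teq]]]] :=
    bounded_tails_decomposed (regular_bounded_tails Xreg Xscat XCS).
  by exists m, kappa, t; split=> // i; have [] := kinf i.
move=> [m [kappa [t [kinf kdec tS teq]]]].
have [tinf _] := infinite_tails_concat (fun i => (infinite_embeds _).1 (kinf i)) kdec tS.
(* The cycle closes through a zero-dimensional realization, which is regular. *)
have [X [/zero_dim_regular Xreg Xscat XCS]] : exists X : topologicalType,
    [/\ zero_dim_hausdorff X, scattered X & is_CS s X].
  apply: zero_dim_of_bounded; case: teq => [|[n [n0]]] /bounded_tails_eq; apply.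
    exact: infinite_bounded_tails.
  exact: bounded_tails_rcons.
by exists X.
Qed.
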